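(* Let $M$ be a minimally vertically $4$-connected matroid with a triangle $T$. Then (1) $M$ has a $4$-element cocircuit that contains exactly two elements of $T$, or (2) $M$ has a $5$-element cocircuit that contains a triangle and exactly two elements of $T$, or (3) $|E(M)| \le 11$.
   Context: For a matroid $M$ with ground set $E$ and rank function $r$, the connectivity function is $\lambda_M(X) = r(X) + r(E-X) - r(M)$. For a positive integer $j$, a partition $(X,Y)$ of $E$ is a vertical $j$-separation of $M$ if $\lambda_M(X) < j$ and $\min\{r(X), r(Y)\} \ge j$. For an integer $k \ge 2$, $M$ is vertically $k$-connected if it has no vertical $j$-separation with $j < k$. $M$ is minimally vertically $k$-connected if it is vertically $k$-connected and $M \setminus e$ is not vertically $k$-connected for every element $e$ of $M$. A triangle is a $3$-element circuit. *)

(* Defs.v *)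
From mathcomp Require Import all_boot.

Set Implicit Arguments.
Unset Strict Implicit.
Unset Printing Implicit Defensive.

(* The ground set is a subset of an ambient finite type, so that deletion does
   not change the type of the elements. *)
Record matroid (T : finType) := Matroid {
  ground : {set T};
  indep : pred {set T};
  indep_ground : forall I : {set T}, indep I -> I \subset ground;
  indep0 : indep set0;
  indepS : forall I J : {set T}, indep J -> I \subset J -> indep I;
  indep_aug : forall I J : {set T}, indep I -> indep J -> #|I| < #|J| ->
    exists2 e, e \in J :\: I & indep (e |: I)
}.

Section MatroidTheory.
Variables (T : finType) (M : matroid T).
Implicit Types (X Y I J B C : {set T}) (e : T) (j k : nat).

Definition rank X : nat := \max_(I : {set T} | indep M I && (I \subset X)) #|I|.

Definition basis B : bool := maxset (indep M) B.

Definition circuit C : bool :=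
  minset [pred X : {set T} | (X \subset ground M) && ~~ indep M X] C.

Definition triangle C : bool := circuit C && (#|C| == 3).

Lemma leq_rank_ground X : rank (ground M) <= rank X + rank (ground M :\: X).
Proof.
apply/bigmax_leqP => I /andP[indI IE].
rewrite -(cardsID X I); apply: leq_add.
  apply: (@leq_bigmax_cond _ _ (fun I : {set T} => #|I|)).
  by rewrite subsetIr (indepS indI) ?subsetIl.
apply: (@leq_bigmax_cond _ _ (fun I : {set T} => #|I|)).
by rewrite (indepS indI) ?subsetDl // setSD.
Qed.

(* By leq_rank_ground, the subtraction never truncates. *)
Definition connectivity X : nat :=
  rank X + rank (ground M :\: X) - rank (ground M).

Definition vertical_separation j X Y : bool :=
  [&& X :|: Y == ground M, [disjoint X & Y],
      connectivity X < j & j <= minn (rank X) (rank Y)].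

(* Meaningful for 2 <= k. *)
Definition vertically_connected k : Prop :=
  forall j X Y, 0 < j -> j < k -> ~~ vertical_separation j X Y.

Definition delete_indep e I : bool := (e \notin I) && indep M I.

Fact delete_ground e I : delete_indep e I -> I \subset ground M :\ e.
Proof. by case/andP=> eI /indep_ground IE; rewrite subsetD1 IE. Qed.

Fact delete_indep0 e : delete_indep e set0.
Proof. by rewrite /delete_indep inE indep0. Qed.

Fact delete_indepS e I J : delete_indep e J -> I \subset J -> delete_indep e I.
Proof.
case/andP=> eJ indJ IJ; rewrite /delete_indep (indepS indJ IJ) andbT.
by apply: contra eJ; apply: (subsetP IJ).
Qed.

Fact delete_aug e I J : delete_indep e I -> delete_indep e J -> #|I| < #|J| ->
  exists2 f, f \in J :\: I & delete_indep e (f |: I).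
Proof.
case/andP=> eI indI /andP[eJ indJ] ltIJ.
have [f fJI indf] := indep_aug indI indJ ltIJ.
exists f => //; rewrite /delete_indep indf andbT !inE negb_or eI andbT.
by apply: contraNneq eJ => ->; case/setDP: fJI.
Qed.

Definition delete e : matroid T :=
  Matroid (@delete_ground e) (delete_indep0 e) (@delete_indepS e)
    (@delete_aug e).

Lemma basis_indep B : basis B -> indep M B.
Proof. by case/maxsetP. Qed.

Lemma leq_indep_basis I B : indep M I -> basis B -> #|I| <= #|B|.
Proof.
move=> indI /maxsetP[indB maxB]; rewrite leqNgt; apply/negP => ltBI.
have [e /setDP[_ /negP eB] inde] := indep_aug indB indI ltBI.
by apply: eB; rewrite -(maxB _ inde (subsetUr _ _)) setU11.
Qed.

Lemma extend_basis I B : indep M I -> basis B ->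
  exists2 B', basis B' & (I \subset B') && (B' \subset I :|: B).
Proof.
move=> indI bB.
pose P := [pred X : {set T} | indep M X && (X \subset I :|: B)].
have [B' /maxsetP[/andP[indB' B'IB] maxB'] IB'] : {X | maxset P X & I \subset X}.
  by apply: maxset_exists; rewrite /= indI subsetUl.
have leBB' : #|B| <= #|B'|.
  rewrite leqNgt; apply/negP => /(indep_aug indB' (basis_indep bB)).
  case=> e /setDP[eB /negP eB'] inde; apply: eB'.
  rewrite -(maxB' (e |: B')) ?setU11 ?subsetUr //=.
  by rewrite inde subUset sub1set inE eB orbT B'IB.
exists B'; last by rewrite IB'.
apply/maxsetP; split=> // X indX B'X; apply/esym/eqP.
by rewrite eqEcard B'X (leq_trans (leq_indep_basis indX bB)).
Qed.

Definition dual_indep I : bool :=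
  (I \subset ground M) && [exists B : {set T}, basis B && [disjoint B & I]].

Fact dual_ground I : dual_indep I -> I \subset ground M.
Proof. by case/andP. Qed.

Fact dual_indep0 : dual_indep set0.
Proof.
have [B bB _] := maxset_exists (indep0 M).
rewrite /dual_indep sub0set; apply/existsP; exists B.
by rewrite /basis bB disjoint_sym disjoints_subset sub0set.
Qed.

Fact dual_indepS I J : dual_indep J -> I \subset J -> dual_indep I.
Proof.
case/andP=> JE /existsP[B /andP[bB dBJ]] IJ; apply/andP; split.
  exact: subset_trans JE.
by apply/existsP; exists B; rewrite bB (disjointWr IJ).
Qed.

Fact dual_aug I J : dual_indep I -> dual_indep J -> #|I| < #|J| ->
  exists2 e, e \in J :\: I & dual_indep (e |: I).
Proof.
case/andP=> IE /existsP[B1 /andP[bB1 dB1]].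
case/andP=> JE /existsP[B2 /andP[bB2 dB2]] ltIJ.
have indB2I : indep M (B2 :\: I) by rewrite (indepS (basis_indep bB2)) ?subsetDl.
have [B bB /andP[B2B BB1]] := extend_basis indB2I bB1.
have dBI : [disjoint B & I].
  apply: disjointWl BB1 _; rewrite disjoints_subset subUset.
  by rewrite -!disjoints_subset dB1 andbT disjoints_subset setDE subsetIr.
have [JIB | ] := boolP (J :\: I \subset B); last first.
  case/subsetPn=> e eJI eB; exists e => //; case/setDP: eJI => eJ eI.
  rewrite /dual_indep subUset sub1set (subsetP JE) //= IE /=.
  apply/existsP; exists B; rewrite bB disjoint_sym disjoints_subset subUset.
  by rewrite sub1set inE eB -disjoints_subset disjoint_sym.
have leB : #|B| <= #|B2| by rewrite leq_indep_basis ?basis_indep.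
have : #|(B2 :\: I) :|: (J :\: I)| <= #|B| by rewrite subset_leq_card // subUset B2B.
have dd : [disjoint B2 :\: I & J :\: I].
  exact: disjointWl (subsetDl _ _) (disjointWr (subsetDl _ _) dB2).
move: (leq_card_setU (B2 :\: I) (J :\: I)); rewrite dd => -[_ /eqP ->] le2.
have leI : #|B2 :&: I| <= #|I :\: J|.
  apply/subset_leq_card/subsetP => x /setIP[xB xI]; rewrite inE xI andbT.
  by rewrite (disjointFr dB2 xB).
have ltD : #|I :\: J| < #|J :\: I|.
  by move: ltIJ; rewrite -(cardsID J I) -(cardsID I J) setIC ltn_add2l.
have := leq_trans le2 leB; rewrite -(cardsID I B2) addnC leq_add2r => leJ.
by have := leq_trans ltD (leq_trans leJ leI); rewrite ltnn.
Qed.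

Definition dual : matroid T :=
  Matroid dual_ground dual_indep0 dual_indepS dual_aug.

End MatroidTheory.

Definition cocircuit (T : finType) (M : matroid T) (C : {set T}) : bool :=
  circuit (dual M) C.

Definition minimally_vertically_connected
    (T : finType) (M : matroid T) (k : nat) : Prop :=
  vertically_connected M k /\
  forall e, e \in ground M -> ~ vertically_connected (delete M e) k.

(* Main.v *)
(* Vertical 4-connectivity says that two nonspanning sets X, Y covering E satisfy
   r(X) + r(Y) >= r(M) + 3.  Suppose that r(M) >= 4 (otherwise deleting an element
   leaves a union of two lines, and lines have at most three points) and that
   no cocircuit as in (1) or (2) exists.  Deleting a, b, c in turn from the
   triangle T = {a, b, c} yields covers a + X + Y, b + P + Q, c + R + S of E with
   rank sums r(M) + 2, where b, a, a are in X, P, R and c, c, b are in Y, Q, S.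
   Uncrossing two of them, together with the absence of the cocircuits, shows that
   the opposite cells X & Q and Y & P have rank 2 and that rank is modular there;
   hence all six sides have the same rank, and then the cell Y & Q containing c
   has rank at most 2 as well.  As the closure of no side of the third cover
   contains c, each side meets Y & Q in at most one element.  Outside T, every
   element lies in two of X, Q, R or in two of Y, P, S; each of these two majority
   sets has at most four elements, so |E| <= 3 + 4 + 4. *)

Require Import Defs.
From mathcomp Require Import all_boot.
From mathcomp Require Import zify.

Set Implicit Arguments.
Unset Strict Implicit.
Unset Printing Implicit Defensive.

(** * Automation for set inclusions and rank arithmetic *)

Lemma subset_in_imply (U : finType) (A B : {set U}) x :
  A \subset B -> (x \in A) ==> (x \in B).
Proof. by move/subsetP/(_ x)/implyP. Qed.

Lemma in_imply_subset (U : finType) (A B : {set U}) :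
  (forall x, (x \in A) ==> (x \in B)) -> A \subset B.
Proof. by move=> AB; apply/subsetP => x; apply/implyP. Qed.

(* Decides inclusions between boolean combinations of sets, given inclusions,
   memberships and non-memberships in the context. *)
Ltac inclusion :=
  let x := fresh "x" in
  apply: in_imply_subset => x;
  repeat match goal with
    | H : is_true (_ \subset _) |- _ => move: (subset_in_imply x H); clear H end;
  rewrite ?inE;
  repeat match goal with
    |- context [x == ?y] =>
      case: (eqVneq x y) => [?|_]; [subst y; rewrite ?eqxx|] end;
  repeat match goal with
    | H : is_true (x \in _) |- _ => rewrite ?H; clear H
    | H : is_true (x \notin _) |- _ => rewrite ?(negbTE H); clear H end;
  repeat match goal with
    |- context [in_mem ?y ?A] =>
      let b := fresh "b" in move: (in_mem y A) => b end;
  repeat match goal with b : bool |- _ => case: b => //= end;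
  try done.

(* Boolean hypotheses other than inequalities only cause case splits in [lia]. *)
Ltac arith :=
  repeat match goal with
    | H : is_true ?b |- _ => lazymatch b with leq _ _ => fail | _ => clear H end
    end;
  lia.

(** * Rank: submodularity, closure and cocircuits *)

Section Rank.
Variables (U : finType) (M : matroid U).
Implicit Types (X Y Z I J D L : {set U}) (e f : U).
Local Notation E := (ground M).
Local Notation r := (rank M).

Lemma rank_leq_card X : r X <= #|X|.
Proof. by apply/bigmax_leqP => I /andP[_ /subset_leq_card]. Qed.

Lemma indep_leq_rank I X : indep M I -> I \subset X -> #|I| <= r X.
Proof.
move=> iI IX.
by apply: (@leq_bigmax_cond _ _ (fun I : {set U} => #|I|)); rewrite iI.
Qed.

Lemma indep_rank I : indep M I -> r I = #|I|.
Proof.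
by move=> iI; apply/eqP; rewrite eqn_leq rank_leq_card indep_leq_rank.
Qed.

Lemma rank_attained X : exists2 I, indep M I && (I \subset X) & #|I| = r X.
Proof.
have P0 : indep M set0 && (set0 \subset X) by rewrite indep0 sub0set.
rewrite /rank (bigmax_eq_arg set0) //.
by case: arg_maxnP => // I PI _; exists I.
Qed.

Lemma rank_indep X : r X = #|X| -> indep M X.
Proof.
have [I /andP[iI IX] <-] := rank_attained X => eqIX.
by have /eqP<- : I == X by rewrite eqEcard IX eqIX /=.
Qed.

Lemma rank_extend I X : indep M I -> I \subset X ->
  exists J, [/\ indep M J, I \subset J, J \subset X & #|J| = r X].
Proof.
move=> iI IX.
pose P := [pred Z : {set U} | indep M Z && (Z \subset X)].
have [J /maxsetP[/andP[iJ JX] maxJ] IJ] : {J | maxset P J & I \subset J}.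
  by apply: maxset_exists; rewrite /= iI.
exists J; split=> //; apply/eqP; rewrite eqn_leq indep_leq_rank //=.
have [K /andP[iK KX] <-] := rank_attained X.
rewrite leqNgt; apply/negP => /(indep_aug iJ iK)[e /setDP[eK /negP eJ] ie].
apply: eJ; rewrite -(maxJ (e |: J)) ?setU11 ?subsetUr //=.
by rewrite ie subUset sub1set (subsetP KX).
Qed.

Lemma rankS X Y : X \subset Y -> r X <= r Y.
Proof.
move=> XY; have [I /andP[iI IX] <-] := rank_attained X.
by rewrite indep_leq_rank // (subset_trans IX).
Qed.

(** Submodularity merged with monotonicity, so that each use leaves only inclusions to check. A
    basis of [X :&: Y] extended to one of [X :|: Y] meets [X] and [Y] in independent sets. *)
Lemma rank_submod X Y Z I : Z \subset X :|: Y -> I \subset X :&: Y ->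
  r Z + r I <= r X + r Y.
Proof.
move=> /rankS leZ /rankS leI; apply: leq_trans (leq_add leZ leI) _.
have [K /andP[iK KXY] <-] := rank_attained (X :&: Y).
have KXUY : K \subset X :|: Y by inclusion.
have [J [iJ KJ JXY <-]] := rank_extend iK KXUY.
have leX : #|J :&: X| <= r X.
  by rewrite indep_leq_rank ?subsetIr // (indepS iJ) ?subsetIl.
have leY : #|J :&: Y| <= r Y.
  by rewrite indep_leq_rank ?subsetIr // (indepS iJ) ?subsetIl.
apply: leq_trans (leq_add leX leY); rewrite -(cardsUI (J :&: X)).
apply: leq_add; apply: subset_leq_card; inclusion.
Qed.

Lemma rankU_leq X Y Z : Z \subset X :|: Y -> r Z <= r X + r Y.
Proof.
by move=> ZXY; rewrite (leq_trans (leq_addr (r set0) _)) ?rank_submod ?sub0set.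
Qed.

Lemma rankU1_leq e X : r (e |: X) <= (r X).+1.
Proof.
have := @rankU_leq [set e] X _ (subxx _); have := rank_leq_card [set e].
by rewrite cards1; lia.
Qed.

(** Monotonicity of closure: [r (e |: X) <= r X] encodes that [e] is in the closure of [X]. *)
Lemma rankU1_subset e X Y : X \subset Y -> r (e |: X) <= r X ->
  r (e |: Y) <= r Y.
Proof.
move=> XY le; have le2 : r (e |: Y) + r X <= r (e |: X) + r Y.
  by apply: rank_submod; inclusion.
by lia.
Qed.

Lemma rank_leq_ground X : r X <= r E.
Proof.
have [I /andP[iI _] <-] := rank_attained X.
by rewrite indep_leq_rank ?indep_ground.
Qed.

Lemma dual_indepE D : D \subset E ->
  dual_indep M D = (r E <= r (E :\: D)).
Proof.
move=> DE; rewrite /dual_indep DE /=; apply/existsP/idP => [[B /andP[bB dBD]]|].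
  have [J [iJ BJ JE <-]] :=
    rank_extend (basis_indep bB) (indep_ground (basis_indep bB)).
  rewrite (leq_trans (leq_indep_basis iJ bB)) // indep_leq_rank ?basis_indep //.
  by rewrite subsetD dBD (indep_ground (basis_indep bB)).
have [I /andP[iI]] := rank_attained (E :\: D); rewrite subsetD => /andP[IE dID] <- le.
exists I; rewrite dID andbT; apply/maxsetP; split=> // J iJ IJ; apply/esym/eqP.
by rewrite eqEcard IJ (leq_trans _ le) ?indep_leq_rank ?indep_ground.
Qed.

Lemma cocircuit_exists D : D \subset E -> r (E :\: D) < r E ->
  exists C, [/\ cocircuit M C, C \subset D & r (E :\: C) < r E].
Proof.
move=> DE lt.
have [C minC CD] : {C | cocircuit M C & C \subset D}.
  by apply: minset_exists; rewrite /= DE dual_indepE // -ltnNge.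
exists C; split=> //; case/minsetP: minC => /andP[/= CE].
by rewrite dual_indepE // -ltnNge.
Qed.

End Rank.

(** * Deletion and vertical connectivity in terms of rank *)

Lemma rank_delete (U : finType) (M : matroid U) e (X : {set U}) :
  rank (delete M e) X = rank M (X :\ e).
Proof.
apply: eq_bigl => I; rewrite subsetD1 /= /delete_indep.
by case: (e \in I); rewrite /= ?andbF ?andbT.
Qed.

(** Only [j = connectivity X + 1] matters: both sides have rank at least this [j] exactly when both
    are nonspanning. *)
Lemma vertically_connectedP (U : finType) (M : matroid U) k :
  vertically_connected M k <->
  forall X : {set U}, X \subset ground M ->
    rank M X < rank M (ground M) ->
    rank M (ground M :\: X) < rank M (ground M) ->
    rank M (ground M) + k <= (rank M X + rank M (ground M :\: X)).+1.
Proof.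
split=> [vc X XE ltX ltY | vc j X Y j_gt0 ltjk].
  rewrite leqNgt; apply/negP => lt.
  have le := leq_rank_ground M X.
  have ltk : (connectivity M X).+1 < k by rewrite /connectivity; lia.
  apply: (negP (vc _ X (ground M :\: X) (ltn0Sn _) ltk)).
  apply/and4P; split=> //; last by rewrite /connectivity; lia.
    by rewrite eqEsubset; apply/andP; split; inclusion.
  by rewrite disjoints_subset; inclusion.
apply/negP => /and4P[/eqP XYE dXY ltj lej].
have XE : X \subset ground M by rewrite -XYE subsetUl.
have defY : ground M :\: X = Y.
  by rewrite -XYE setDUl setDv set0U; apply/setDidPl; rewrite disjoint_sym.
have := vc X XE; have := leq_rank_ground M X.
by move: ltj; rewrite /connectivity defY; lia.
Qed.

(** * Minimal vertical 4-connectivity: simplicity and lines of at most three points *)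

Section MinimallyVertically4Connected.
Variables (U : finType) (M : matroid U).
Implicit Types (X Y Z D L : {set U}) (e f : U).
Local Notation E := (ground M).
Local Notation r := (rank M).

Hypothesis minM : minimally_vertically_connected M 4.
Hypothesis rank_gt1 : 1 < r E.

Lemma vertical_bound X Y : E \subset X :|: Y -> r X < r E -> r Y < r E ->
  r E + 3 <= r X + r Y.
Proof.
move=> EXY ltX ltY; have /vertically_connectedP vc := minM.1.
have leX : r (X :&: E) <= r X by rewrite rankS ?subsetIl.
have leY : r (E :\: (X :&: E)) <= r Y by apply: rankS; inclusion.
by have := vc (X :&: E) (subsetIr _ _); lia.
Qed.

Lemma vertical_spanning X Y : E \subset X :|: Y -> r X < r E ->
  r X + r Y <= r E + 2 -> r Y = r E.
Proof.
move=> EXY ltX le; apply/eqP; rewrite eqn_leq rank_leq_ground leqNgt.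
by apply/negP => ltY; have := vertical_bound EXY ltX ltY; lia.
Qed.

(** The sides come from a vertical separation of [delete M e]. If one of them spanned [e], adding
    [e] to it would contradict [vertical_bound]. *)
Lemma deletion_separation e : e \in E ->
  exists X Y, [/\ E \subset e |: (X :|: Y), X \subset E & Y \subset E] /\
    [/\ r X < r E, r Y < r E, r X < r (e |: X), r Y < r (e |: Y)
      & r X + r Y <= r E + 2].
Proof.
(* As [r E > 1], the set [[set e]] is nonspanning, so its complement spans and deleting [e] keeps
   the rank. *)
move=> eE; have rE' : r (E :\ e) = r E.
  have EeE : E \subset [set e] :|: (E :\ e) by inclusion.
  have r1 := rank_leq_card M [set e]; rewrite cards1 in r1.
  have le := rankU_leq M EeE.
  by apply: (vertical_spanning EeE); have := rank_leq_ground M (E :\ e); lia.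
have [/existsP[X /and4P[XE ltX ltY lt]] | noX] := boolP [exists X : {set U},
   [&& X \subset E :\ e, r X < r E, r ((E :\ e) :\: X) < r E
     & r X + r ((E :\ e) :\: X) <= r E + 2]].
  exists X, ((E :\ e) :\: X); have ltU Z Z' : E \subset (e |: Z) :|: Z' ->
      r Z < r E -> r Z' < r E -> r Z + r Z' <= r E + 2 -> r Z < r (e |: Z).
    move=> EZ ltZ ltZ' le; rewrite ltnNge; apply/negP => leZ.
    by have := @vertical_bound (e |: Z) Z' EZ; lia.
  split; split=> //; try inclusion.
    by apply: ltU ltX ltY _ => //; inclusion.
  by apply: ltU ltY ltX _; [inclusion | lia].
case: (minM.2 e eE); apply/vertically_connectedP => X /= XE.
rewrite !rank_delete; have -> : X :\ e = X.
  by apply/eqP; rewrite eqEsubset; apply/andP; split; inclusion.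
have -> : ((E :\ e) :\: X) :\ e = (E :\ e) :\: X.
  by apply/eqP; rewrite eqEsubset; apply/andP; split; inclusion.
have -> : (E :\ e) :\ e = E :\ e.
  by apply/eqP; rewrite eqEsubset; apply/andP; split; inclusion.
rewrite rE' => ltX ltY; move/existsPn/(_ X): noX.
by rewrite XE ltX ltY /= -ltnNge; lia.
Qed.

Lemma rank_set1 e : e \in E -> r [set e] = 1.
Proof.
move=> eE; have [X [Y [_ [_ _ ltX _ _]]]] := deletion_separation eE.
have := rank_leq_card M [set e]; rewrite cards1.
by have := rankU_leq M (subxx (e |: X)); lia.
Qed.

Lemma rank_set2 e f : e \in E -> f \in E -> e != f -> r [set e; f] = 2.
Proof.
move=> eE fE neq.
have [X [Y [[EXY _ _] [_ _ ltX ltY _]]]] := deletion_separation eE.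
have := rank_leq_card M [set e; f]; rewrite cards2 neq.
have rf := rank_set1 fE.
have le Z : f \in Z -> r Z < r (e |: Z) -> 1 < r [set e; f].
  move=> fZ ltZ; have : r (e |: Z) + r [set f] <= r Z + r [set e; f].
    by apply: rank_submod; inclusion.
  by lia.
have := subsetP EXY f fE; rewrite !inE eq_sym (negPf neq) /=.
by case/orP => /le; lia.
Qed.

Lemma card_rank1 L : L \subset E -> r L <= 1 -> #|L| <= 1.
Proof.
move=> LE; apply: contraTT; rewrite -!ltnNge => /card_gt1P[x [y [xL yL neq]]].
rewrite -(rank_set2 _ _ neq) ?(subsetP LE) //; apply: rankS; inclusion.
Qed.

Lemma indep_card2 L : L \subset E -> #|L| <= 2 -> indep M L.
Proof.
move=> LE leL; apply: rank_indep; apply/eqP; rewrite eqn_leq rank_leq_card /=.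
have [le1|gt1] := leqP (r L) 1; last by lia.
case: (set_0Vmem L) => [-> | [x xL]]; first by rewrite cards0.
have : r [set x] <= r L by rewrite rankS ?sub1set.
by rewrite (rank_set1 (subsetP LE x xL)); apply: leq_trans (card_rank1 LE le1).
Qed.

(** By submodularity, [L :&: X] has rank at most 1, because [X :|: L] has rank above [r X]. *)
Lemma card_span_avoiding e X L : r X < r (e |: X) -> L \subset E ->
  e \in L -> r L <= 2 -> #|L :&: X| <= 1.
Proof.
move=> ltX LE eL leL; apply: card_rank1; first by inclusion.
have : r (e |: X) + r (L :&: X) <= r X + r L by apply: rank_submod; inclusion.
by lia.
Qed.

(** For [e] in [L], each side of a separation of [delete M e] contains at most one point of [L]. *)
Lemma card_rank2 L : L \subset E -> r L <= 2 -> #|L| <= 3.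
Proof.
move=> LE leL; case: (set_0Vmem L) => [-> | [e eL]]; first by rewrite cards0.
have [X [Y [[EXY _ _] [_ _ ltX ltY _]]]] :=
  deletion_separation (subsetP LE e eL).
have := card_span_avoiding ltX LE eL leL.
have := card_span_avoiding ltY LE eL leL.
have : L \subset e |: (L :&: X :|: L :&: Y) by inclusion.
move/subset_leq_card; rewrite cardsU1; have := leq_card_setU (L :&: X) (L :&: Y).
by move=> -[le _]; case: (_ \notin _) => /=; lia.
Qed.

Lemma triangle_rank2 L : L \subset E -> #|L| = 3 -> r L <= 2 -> triangle M L.
Proof.
move=> LE cL rL; rewrite /triangle cL eqxx andbT; apply/minsetP; split=> /=.
  by rewrite LE /=; apply/negP => /indep_rank; lia.
move=> Y /andP[YE niY] YL; apply/eqP; rewrite eqEcard YL cL ltnNge.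
by apply: contra niY; apply: indep_card2.
Qed.

(** The count is [1 + 3 + 3]: a deleted element and two sides of rank at most 2. *)
Lemma card_ground_rank3 : r E <= 3 -> #|E| <= 7.
Proof.
move=> le3; have /card_gt0P[e eE] : 0 < #|E| by have := rank_leq_card M E; lia.
have [X [Y [[EXY XE YE] [ltX ltY _ _ _]]]] := deletion_separation eE.
have := card_rank2 XE; have := card_rank2 YE.
have := subset_leq_card EXY; rewrite cardsU1.
have [le _] := leq_card_setU X Y.
by case: (_ \notin _) => /=; lia.
Qed.

End MinimallyVertically4Connected.

(** * The triangle and its splits when the rank exceeds 3 and the two kinds of cocircuits are
    absent *)

Section NoSmallCocircuit.
Variables (U : finType) (M : matroid U) (T : {set U}).
Implicit Types (X Y Z D L P Q R S : {set U}) (a b c e : U).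
Local Notation E := (ground M).
Local Notation r := (rank M).

Hypothesis minM : minimally_vertically_connected M 4.
Hypothesis rank_gt3 : 3 < r E.
Hypothesis triT : triangle M T.
Hypothesis no_cocircuit4 :
  forall C, cocircuit M C -> #|C :&: T| = 2 -> #|C| <> 4.
Hypothesis no_cocircuit5 : forall C L, cocircuit M C -> #|C :&: T| = 2 ->
  triangle M L -> L \subset C -> #|C| <> 5.

Let rank_gt1 : 1 < r E := ltnW (ltnW rank_gt3).

Lemma triangleS : T \subset E.
Proof. by case/andP: triT => /minsetP[/andP[]]. Qed.

Lemma triangle_spans a b c Z : T = [set a; b; c] ->
  b \in Z -> c \in Z -> r (a |: Z) <= r Z.
Proof.
move=> defT bZ cZ; have /andP[/minsetP[/= /andP[TE niT] minT] /eqP cT] := triT.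
apply: (@rankU1_subset _ _ a [set b; c]); first by inclusion.
have ->: a |: [set b; c] = T by rewrite defT setUA.
have neT : [set b; c] != T.
  by apply/eqP => eqT; move: cT; rewrite -eqT cards2; case: (b != c).
have bcT : [set b; c] \subset T by rewrite defT; inclusion.
have ibc : indep M [set b; c].
  apply: contraNT neT => nibc; rewrite (minT _ _ bcT) //=.
  by rewrite (subset_trans bcT TE).
have cbc : 2 <= #|[set b; c]|.
  by move: cT; rewrite defT -setUA cardsU1; case: (_ \notin _) => /=; arith.
have rT : r T <> #|T| by move/rank_indep; apply/negP.
by have := rank_leq_card M T; have := indep_rank ibc; arith.
Qed.

(** As [r E > 3], the set [D] is nonspanning, and a nonspanning [Z] would violate [vertical_bound].
    Hence cocircuits have at least four elements. *)
Lemma spanning_cocard D Z : E \subset D :|: Z -> #|D| <= 3 -> r Z = r E.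
Proof.
move=> EDZ leD; have := rank_leq_card M D => le; apply/eqP.
rewrite eqn_leq rank_leq_ground leqNgt; apply/negP => ltZ.
by have := vertical_bound minM rank_gt1 EDZ; arith.
Qed.

(** The complement of [Z] contains a cocircuit [C]. It contains [a] and [b], since adding either to
    [Z] spans, but not [c]; so it meets [T] in two elements and has at least five elements. If
    [#|D| = 5], then [C = D], which may not contain a triangle. *)
Lemma cocard_bound a b c Z D : T = [set a; b; c] -> c \in Z -> Z \subset E ->
    E \subset Z :|: D -> D \subset E -> r Z < r E -> r E <= r (a |: Z) ->
  4 < #|D| /\ forall L, L \subset D -> r L <= 2 -> 2 < #|L| -> 5 < #|D|.
Proof.
move=> defT cZ ZE EZD DE ltZ leaZ; have TE := triangleS.
have [aT bT cT] : [/\ a \in T, b \in T & c \in T].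
  by rewrite defT !inE !eqxx !orbT.
have lebZ : r E <= r (b |: Z).
  apply: leq_trans leaZ _; apply: (@leq_trans (r (a |: (b |: Z)))).
    by apply: rankS; inclusion.
  by apply: (triangle_spans defT); rewrite !inE ?eqxx ?cZ ?orbT.
have ltD0 : r (E :\: (E :\: Z)) < r E.
  by apply: leq_ltn_trans ltZ; apply: rankS; inclusion.
have [C [cocC CD0 ltC]] := cocircuit_exists (subsetDl E Z) ltD0.
have memC e : e \in T -> r E <= r (e |: Z) -> e \in C.
  move=> eT lee; apply: contraTT ltC => eC; rewrite -leqNgt.
  by apply: leq_trans lee _; apply: rankS; inclusion.
have aC := memC a aT leaZ; have bC := memC b bT lebZ.
have CE : C \subset E by inclusion.
have CT : #|C :&: T| = 2.
  have -> : C :&: T = T :\ c.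
    apply/eqP; rewrite eqEsubset; apply/andP; split; first by inclusion.
    by rewrite defT; inclusion.
  have /andP[_ /eqP card3] := triT.
  by have := cardsD1 c T; rewrite cT card3 => -[->].
have leCD : #|C| <= #|D| by apply: subset_leq_card; inclusion.
have gtC : 3 < #|C|.
  rewrite ltnNge; apply/negP => leC.
  have EC : E \subset C :|: (E :\: C) by inclusion.
  by have := spanning_cocard EC leC; arith.
have := no_cocircuit4 cocC CT => neq4; split=> [|L LD leL gtL]; first by arith.
have LE := subset_trans LD DE.
rewrite ltnNge; apply/negP => leD.
have eqCD : C = D.
  apply/eqP; rewrite eqEcard; apply/andP; split; first by inclusion.
  by arith.
apply: (no_cocircuit5 cocC CT (triangle_rank2 minM rank_gt1 LE _ leL)).
- by have := card_rank2 minM rank_gt1 LE leL; arith.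
- by rewrite eqCD.
- by arith.
Qed.

(* [X :\ b] and [Y :\ c] form a vertical 3-separation of [M \ T] whose closures
   contain [b] and [c], respectively. *)
Record split a b c X Y : Prop := Split {
  split_cover : E \subset a |: (X :|: Y);
  split_subl : X \subset E;
  split_subr : Y \subset E;
  split_meml : b \in X;
  split_memr : c \in Y;
  split_rank : r X + r Y = r E + 2;
  split_ltl : r X < r E;
  split_ltr : r Y < r E;
  split_avoidl : r X < r (a |: X);
  split_avoidr : r Y < r (a |: Y);
  split_closl : r X <= r (X :\ b);
  split_closr : r Y <= r (Y :\ c)
}.

Lemma splitC a b c X Y : split a b c X Y -> split a c b Y X.
Proof. by case=> *; split=> //; rewrite 1?[X in _ |: X]setUC 1?addnC. Qed.

(** Otherwise move [b] to the other side: [W] has rank at most [r Y + 1], so it must span, and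
    [X :\ b] is left with rank at most 2. Then [a |: X] has at most five elements and contradicts
    [cocard_bound]. *)
Lemma split_closure a b c X Y : T = [set a; b; c] ->
    E \subset a |: (X :|: Y) -> X \subset E -> Y \subset E ->
    r X < r E -> r Y < r E -> r X < r (a |: X) -> r X + r Y = r E + 2 ->
  b \in X -> c \in Y -> r X <= r (X :\ b).
Proof.
move=> defT EXY XE YE ltX ltY avX rXY bX cY; rewrite leqNgt; apply/negP => ltXb.
have [aE bE] : a \in E /\ b \in E.
  by split; apply: (subsetP triangleS); rewrite defT !inE eqxx ?orbT.
pose W := b |: (a |: Y).
have leW : r W <= r (a |: Y).
  apply: (@triangle_spans b a c); rewrite ?inE ?eqxx ?cY ?orbT //.
  by rewrite defT [[set a; b]]setUC.
have le1 := rankU1_leq M a Y.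
have EW : E \subset W :|: (X :\ b) by rewrite /W; inclusion.
have leWE : r E <= r W.
  rewrite leqNgt; apply/negP => ltW.
  by have := vertical_bound minM rank_gt1 EW ltW; arith.
have leXb : #|X :\ b| <= 3.
  by apply: (card_rank2 minM rank_gt1); [inclusion | arith].
have [||||||lt4 lt5] := @cocard_bound a b c Y (a |: X) defT; rewrite ?cY //.
- by inclusion.
- by inclusion.
- by arith.
have cX := cardsD1 b X; rewrite bX in cX.
have := cardsU1 a X; case: (a \notin X) => /= cD.
  have := lt5 (X :\ b); have LD : X :\ b \subset a |: X by inclusion.
  by move/(_ LD); arith.
by arith.
Qed.

Lemma split_exists a b c : T = [set a; b; c] ->
  exists X Y, split a b c X Y.
Proof.
move=> defT.
have [aE bE cE] : [/\ a \in E, b \in E & c \in E].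
  by split; apply: (subsetP triangleS); rewrite defT !inE eqxx ?orbT.
have [X [Y [[EXY XE YE] [ltX ltY avX avY le]]]] :=
  deletion_separation minM rank_gt1 aE.
(* For the lower bound: if [a] added to one side does not span, [vertical_bound] applies; if it
   spans with both sides, the sum is at least [2 * (r E - 1)], and [r E >= 4]. *)
have rXY : r X + r Y = r E + 2.
  have EaXY : E \subset (a |: X) :|: Y by inclusion.
  have EXaY : E \subset X :|: (a |: Y) by inclusion.
  have := rankU1_leq M a X; have := rankU1_leq M a Y.
  have [ltaX|] := ltnP (r (a |: X)) (r E).
    by have := vertical_bound minM rank_gt1 EaXY ltaX ltY; arith.
  have [ltaY|] := ltnP (r (a |: Y)) (r E).
    by have := vertical_bound minM rank_gt1 EXaY ltX ltaY; arith.
  by arith.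
(* Neither side spans [a], so [b] and [c] must be on different sides. *)
have not_both Z : r Z < r (a |: Z) -> ~ (b \in Z /\ c \in Z).
  by move=> ltZ [bZ cZ]; have := triangle_spans defT bZ cZ; arith.
have defT' : T = [set a; c; b] by rewrite defT -!setUA [[set b] :|: _]setUC.
have EYX : E \subset a |: (Y :|: X) by rewrite [Y :|: X]setUC.
have rYX : r Y + r X = r E + 2 by rewrite addnC.
have mem e : e \in E -> e != a -> (e \in X) || (e \in Y).
  by move=> /(subsetP EXY); rewrite !inE => /orP[->|].
have cT : #|T| = 3 by case/andP: triT => _ /eqP.
have /andP[neqb neqc] : (b != a) && (c != a).
  move: cT; rewrite defT; apply: contra_eqT; rewrite negb_and !negbK.
  case/orP=> /eqP->; first by rewrite setUid cards2; case: (a != c).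
  by rewrite setUAC setUid cards2; case: (a != b).
case/orP: (mem b bE neqb) => bZ; case/orP: (mem c cE neqc) => cZ.
- by case: (not_both X).
- exists X, Y; split=> //; first exact: (@split_closure a b c X Y).
  exact: (@split_closure a c b Y X).
- exists Y, X; split=> //; first exact: (@split_closure a b c Y X).
  exact: (@split_closure a c b X Y).
- by case: (not_both Y).
Qed.

Lemma split_notin a b c X Y : T = [set a; b; c] -> split a b c X Y ->
  [/\ a \notin X, a \notin Y, c \notin X & b \notin Y].
Proof.
move=> defT sA; have [_ _ _ bX cY _ _ _ avX avY _ _] := sA.
split; apply/negP => memX.
- by move: avX; rewrite (setUidPr _) ?ltnn ?sub1set.
- by move: avY; rewrite (setUidPr _) ?ltnn ?sub1set.
- by have := triangle_spans defT bX memX; arith.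
- by have := triangle_spans defT memX cY; arith.
Qed.

(** * Uncrossing two splits; of the four cells only [Y :&: Q] meets [T] *)

Section TwoSplits.
Variables (a b c : U) (X Y P Q : {set U}).
Hypothesis defT : T = [set a; b; c].
Hypothesis sA : split a b c X Y.
Hypothesis sB : split b a c P Q.

(** The two submodular inequalities have total right-hand side [2 * r E + 4]. Since [X :|: Q] spans
    [a] and [Y :|: P] spans [b], any nonspanning union would push the left-hand side to at least
    [2 * r E + 5]. So both unions span and every inequality is tight. *)
Lemma opposite_ranks : 1 < r (X :&: Q) -> 1 < r (Y :&: P) ->
  [/\ r (X :&: Q) = 2, r (Y :&: P) = 2, r X + r Q = r E + 2
    & r Y + r P = r E + 2].
Proof.
have [cA XE YE bX cY rXY ltX ltY _ _ _ _] := sA.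
have [cB PE QE aP cQ rPQ ltP ltQ _ _ _ _] := sB.
have defT' : T = [set b; a; c] by rewrite defT [[set a; b]]setUC.
move=> gtp gtq.
have subXQ : r (X :|: Q) + r (X :&: Q) <= r X + r Q by exact: rank_submod.
have subYP : r (Y :|: P) + r (Y :&: P) <= r Y + r P by exact: rank_submod.
have leXQ : r (a |: (X :|: Q)) <= r (X :|: Q).
  by apply: (triangle_spans defT); rewrite inE ?bX ?cQ ?orbT.
have leYP : r (b |: (Y :|: P)) <= r (Y :|: P).
  by apply: (triangle_spans defT'); rewrite inE ?aP ?cY ?orbT.
have ltp : r (X :&: Q) < r E by apply: leq_ltn_trans ltX; rewrite rankS ?subsetIl.
have ltq : r (Y :&: P) < r E by apply: leq_ltn_trans ltY; rewrite rankS ?subsetIl.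
have Ep : E \subset (X :&: Q) :|: (b |: (Y :|: P)) by inclusion.
have Eq : E \subset (Y :&: P) :|: (a |: (X :|: Q)) by inclusion.
have [leEYP|ltYP] := leqP (r E) (r (b |: (Y :|: P))); last first.
  have := vertical_bound minM rank_gt1 Ep ltp ltYP.
  have [|ltXQ] := leqP (r E) (r (a |: (X :|: Q))); first by arith.
  by have := vertical_bound minM rank_gt1 Eq ltq ltXQ; arith.
have [leEXQ|ltXQ] := leqP (r E) (r (a |: (X :|: Q))); last first.
  by have := vertical_bound minM rank_gt1 Eq ltq ltXQ; arith.
have := rank_leq_ground M (a |: (X :|: Q)).
have := rank_leq_ground M (b |: (Y :|: P)).
by split; arith.
Qed.

(** Over [Z], which contains [c], the elements [a] and [b] span each other, so adding both costs at
    most 1 in rank. If the result is nonspanning, [vertical_bound] suffices. If it spans and the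
    bound fails, [X :&: P] is a line and, with [a] and [b], contradicts [cocard_bound]. *)
Lemma own_rank_bound : 1 < r (X :&: P) ->
  r E + 2 <= r (X :&: P) + r (Y :|: Q).
Proof.
have [cA XE YE bX cY rXY ltX ltY _ _ _ _] := sA.
have [cB PE QE aP cQ rPQ ltP ltQ _ _ _ _] := sB.
move=> gts; set Z := Y :|: Q.
have [aE bE] : a \in E /\ b \in E by rewrite (subsetP PE) // (subsetP XE).
have cZ : c \in Z by rewrite inE cY.
have leab : r (a |: (b |: Z)) <= r (b |: Z).
  by apply: (triangle_spans defT); rewrite ?inE ?eqxx ?cY ?orbT.
have leba : r (b |: (a |: Z)) <= r (a |: Z).
  apply: (@triangle_spans b a c); rewrite ?inE ?eqxx ?cY ?orbT //.
  by rewrite defT [[set a; b]]setUC.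
have le1 := rankU1_leq M b Z.
have Es : E \subset (X :&: P) :|: (a |: (b |: Z)) by rewrite /Z; inclusion.
have lts : r (X :&: P) < r E by apply: leq_ltn_trans ltX; rewrite rankS ?subsetIl.
have [leE|ltE] := leqP (r E) (r (a |: (b |: Z))); last first.
  by have := vertical_bound minM rank_gt1 Es lts ltE; arith.
rewrite leqNgt; apply/negP => lt.
have rs : r (X :&: P) <= 2 by arith.
have sE : X :&: P \subset E by inclusion.
have les := card_rank2 minM rank_gt1 sE rs.
have ZE : Z \subset E by rewrite /Z; inclusion.
have abE : a |: (b |: (X :&: P)) \subset E by inclusion.
have EZ : E \subset Z :|: (a |: (b |: (X :&: P))) by rewrite /Z; inclusion.
have ltZ : r Z < r E by arith.
have leaZ : r E <= r (a |: Z) by rewrite setUCA in leE; apply: leq_trans leba.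
have [gt4 gt5] := cocard_bound defT cZ ZE EZ abE ltZ leaZ.
have := cardsU1 a (b |: (X :&: P)); have := cardsU1 b (X :&: P).
have sD : X :&: P \subset a |: (b |: (X :&: P)) by inclusion.
move: (gt5 _ sD rs).
by case: (a \notin _); case: (b \notin _) => /=; arith.
Qed.

(** In the first case [own_rank_bound] is played against submodularity. In the second, [X :&: P]
    together with [a] and [b] has at most three elements, so [Y :|: Q] spans. *)
Lemma shared_rank_or : (1 < r (X :&: P) /\ r (Y :&: Q) <= 2) \/
  (r (X :&: P) <= 1 /\ r E + r (Y :&: Q) <= r Y + r Q).
Proof.
have [cA XE YE bX cY rXY ltX ltY _ _ _ _] := sA.
have [cB PE QE aP cQ rPQ ltP ltQ _ _ _ _] := sB.
have subYQ : r (Y :|: Q) + r (Y :&: Q) <= r Y + r Q by exact: rank_submod.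
have subXP : r (X :|: P) + r (X :&: P) <= r X + r P by exact: rank_submod.
have [les|gts] := leqP (r (X :&: P)) 1; [right | left]; split=> //.
  have sE : X :&: P \subset E by inclusion.
  have := card_rank1 minM rank_gt1 sE les => les'.
  have Es : E \subset (a |: (b |: (X :&: P))) :|: (Y :|: Q) by inclusion.
  have le3 : #|a |: (b |: (X :&: P))| <= 3.
    have := cardsU1 a (b |: (X :&: P)); have := cardsU1 b (X :&: P).
    by case: (a \notin _); case: (b \notin _) => /=; arith.
  by have := spanning_cocard Es le3; arith.
have := own_rank_bound gts => own.
have Et : E \subset (Y :&: Q) :|: (X :|: P) by inclusion.
have ltt : r (Y :&: Q) < r E by apply: leq_ltn_trans ltY; rewrite rankS ?subsetIl.
have [|ltXP] := leqP (r E) (r (X :|: P)); first by arith.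
by have := vertical_bound minM rank_gt1 Et ltt ltXP; arith.
Qed.

(** If [X :&: P] has rank at most 1, use that [P :\ a] has rank [r P >= 3]. Otherwise a small
    [Y :&: P] would give [Y] at most [1 + 3] elements and rank at most 3, so that [a |: X] spans and
    [a |: Y] contradicts [cocard_bound]. *)
Lemma opposite_rank_gt1 : 1 < r (Y :&: P).
Proof.
have [cA XE YE bX cY rXY ltX ltY avX _ _ _] := sA.
have [cB PE QE aP cQ rPQ ltP ltQ _ _ clP _] := sB.
have [aX aY cX bY] := split_notin defT sA.
have [[gts let2] | [les _]] := shared_rank_or; last first.
  have PaU : P :\ a \subset (Y :&: P) :|: (X :&: P) by inclusion.
  by have := rankU_leq M PaU; arith.
rewrite ltnNge; apply/negP => leq1.
have YU : Y \subset (Y :&: P) :|: (Y :&: Q) by inclusion.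
have leY := rankU_leq M YU.
have tE : Y :&: Q \subset E by inclusion.
have qE : Y :&: P \subset E by inclusion.
have cardt := card_rank2 minM rank_gt1 tE let2.
have cardq := card_rank1 minM rank_gt1 qE leq1.
have cardY : #|a |: Y| <= 1 + (#|Y :&: P| + #|Y :&: Q|).
  rewrite cardsU1 aY leq_add2l; apply: leq_trans (subset_leq_card YU) _.
  exact: (leq_card_setU _ _).1.
have aE : a \in E by rewrite (subsetP PE).
have aYE : a |: Y \subset E by inclusion.
have EX : E \subset X :|: (a |: Y) by inclusion.
have leaX : r E <= r (a |: X) by arith.
have defT' : T = [set a; c; b] by rewrite defT -!setUA [[set b] :|: _]setUC.
have [gt4 gt5] := cocard_bound defT' bX XE EX aYE ltX leaX.
have tY : Y :&: Q \subset a |: Y by inclusion.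
by move: (gt5 _ tY let2); arith.
Qed.

End TwoSplits.

(** * Cell ranks for all pairs among three splits *)

Lemma cross_ranks a b c X Y P Q : T = [set a; b; c] ->
    split a b c X Y -> split b a c P Q ->
  [/\ r (X :&: Q) = 2, r (Y :&: P) = 2, r X + r Q = r E + 2
    & r Y + r P = r E + 2].
Proof.
move=> defT sA sB; apply: (opposite_ranks defT sA sB).
  rewrite setIC; apply: opposite_rank_gt1 sB sA.
  by rewrite defT [[set a; b]]setUC.
exact: opposite_rank_gt1 sA sB.
Qed.

(* The six sides of the three splits have equal rank [(r E + 2) / 2]. *)
Lemma shared_rank a b c X Y P Q R S : T = [set a; b; c] ->
    split a b c X Y -> split b a c P Q -> split c a b R S ->
  r (Y :&: Q) <= 2.
Proof.
move=> defT sA sB sC.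
have defTacb : T = [set a; c; b] by rewrite defT -!setUA [[set b] :|: _]setUC.
have defTbca : T = [set b; c; a] by rewrite defT -setUA setUC.
have [[_ //] | [les let_]] := shared_rank_or defT sA sB.
(* The sums [r X + r Q], [r X + r R] and [r Q + r R] all equal [r E + 2], which makes the three
   ranks equal; [split_rank] carries this over to [Y], [P] and [S]. Then [let_] bounds the shared
   cell. *)
have [rp _ rXQ rYP] := cross_ranks defT sA sB.
have [_ _ rYS rXR] := cross_ranks defTacb (splitC sA) sC.
have [_ _ rQR rPS] := cross_ranks defTbca (splitC sB) (splitC sC).
have [cA XE YE bX cY rXY ltX ltY _ _ clX _] := sA.
have [cB PE QE aP cQ rPQ ltP ltQ _ _ _ _] := sB.
have XbU : X :\ b \subset (X :&: Q) :|: (X :&: P) by inclusion.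
by have := rankU_leq M XbU; arith.
Qed.

(** * Counting the elements of the ground set *)

(** If the triple intersection has at most one element, the count is [1 + 1 + 1 + 1]. Otherwise it
    has rank 2, and the three pairwise intersections lie on one line, which has at most three
    points. *)
Lemma card_majority X Q R : X \subset E -> Q \subset E -> R \subset E ->
    r (X :&: Q) <= 2 -> r (X :&: R) <= 2 -> r (Q :&: R) <= 2 ->
    #|X :&: Q :\: R| <= 1 -> #|X :&: R :\: Q| <= 1 -> #|Q :&: R :\: X| <= 1 ->
  #|(X :&: Q) :|: (X :&: R) :|: (Q :&: R)| <= 4.
Proof.
move=> XE QE RE rXQ rXR rQR lR lQ lX; set W := _ :|: _.
pose Z := X :&: Q :&: R; have ZE : Z \subset E by rewrite /Z; inclusion.
have [le1|gt1] := leqP #|Z| 1.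
  have : W \subset (Z :|: (X :&: Q :\: R))
      :|: ((X :&: R :\: Q) :|: (Q :&: R :\: X)).
    by rewrite /W /Z; inclusion.
  move=> /subset_leq_card leW; have [le2 _] := leq_card_setU Z (X :&: Q :\: R).
  have [le3 _] := leq_card_setU (X :&: R :\: Q) (Q :&: R :\: X).
  have [] := leq_card_setU (Z :|: (X :&: Q :\: R))
    ((X :&: R :\: Q) :|: (Q :&: R :\: X)).
  by arith.
have rZ : 1 < r Z.
  rewrite ltnNge; apply: contraL gt1 => /(card_rank1 minM rank_gt1 ZE).
  by rewrite -leqNgt.
have le1 : r ((X :&: Q) :|: (X :&: R)) + r Z <= r (X :&: Q) + r (X :&: R).
  by apply: rank_submod => //; rewrite /Z; inclusion.
have le2 : r W + r Z <= r ((X :&: Q) :|: (X :&: R)) + r (Q :&: R).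
  by apply: rank_submod => //; rewrite /Z; inclusion.
have WE : W \subset E by rewrite /W; inclusion.
by apply/ltnW/(card_rank2 minM rank_gt1 WE); arith.
Qed.

Lemma card_ground_rank_gt3 : #|E| <= 11.
Proof.
have /andP[_ /eqP cT] := triT; have TE := triangleS.
have [a [b [c [[aT bT cT'] [neqab neqbc neqca]]]]] : exists a b c,
    [/\ a \in T, b \in T & c \in T] /\ [/\ a != b, b != c & c != a].
  by apply/card_gt2P; rewrite cT.
have defT : T = [set a; b; c].
  apply/esym/eqP; rewrite eqEcard cT; apply/andP; split; first by inclusion.
  by rewrite -setUA cardsU1 cards2 !inE negb_or neqab eq_sym neqca neqbc.
have defTbac : T = [set b; a; c] by rewrite defT [[set a; b]]setUC.
have defTacb : T = [set a; c; b] by rewrite defT -!setUA [[set b] :|: _]setUC.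
have defTbca : T = [set b; c; a] by rewrite defT -setUA setUC.
have defTcab : T = [set c; a; b] by rewrite defT setUC setUA.
have [X [Y sA]] := split_exists defT.
have [P [Q sB]] := split_exists defTbac.
have [R [S sC]] := split_exists defTcab.
have [rXQ rYP _ _] := cross_ranks defT sA sB.
have [rYS rXR _ _] := cross_ranks defTacb (splitC sA) sC.
have [rQR rPS _ _] := cross_ranks defTbca (splitC sB) (splitC sC).
have rYQ := shared_rank defT sA sB sC.
have rXS := shared_rank defTacb (splitC sA) sC sB.
have rPR := shared_rank defTbca (splitC sB) (splitC sC) sA.
have [aX aY cX bY] := split_notin defT sA.
have [bP bQ cP aQ] := split_notin defTbac sB.
have [cR cS bR aS] := split_notin defTcab sC.
have [covA XE YE bX cY _ _ _ avX avY _ _] := sA.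
have [covB PE QE aP cQ _ _ _ avP avQ _ _] := sB.
have [covC RE SE aR bS _ _ _ avR avS _ _] := sC.
have cross L Z e : L \subset E -> r L <= 2 -> e \in L -> r Z < r (e |: Z) ->
    #|L :&: Z| <= 1.
  by move=> LE rL eL avZ; apply: (card_span_avoiding minM rank_gt1 avZ LE eL rL).
have sub1 (W W' : {set U}) : W \subset W' -> #|W'| <= 1 -> #|W| <= 1.
  by move=> sWW'; apply: leq_trans (subset_leq_card sWW').
have [YQE XSE PRE] : [/\ Y :&: Q \subset E, X :&: S \subset E & P :&: R \subset E].
  by split; inclusion.
have [cYQ bXS aPR] : [/\ c \in Y :&: Q, b \in X :&: S & a \in P :&: R].
  by rewrite !inE cY cQ bX bS aP aR.
(* The triples [X, Q, R] and [Y, P, S] are chosen so that their pairwise intersections are the six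
   cells of rank 2 given by [cross_ranks]. *)
pose W := (X :&: Q) :|: (X :&: R) :|: (Q :&: R).
pose W' := (Y :&: P) :|: (Y :&: S) :|: (P :&: S).
have cW : #|W| <= 4.
  apply: card_majority => //; rewrite ?rXQ ?rXR ?rQR //.
  (* An element of [X :&: Q] outside [R] is not [c], so it is in [S]. The line [X :&: S] contains
     [b], which [Q] does not span, so it meets [Q] at most once. *)
  - by apply: sub1 (cross _ Q b XSE rXS bXS avQ); inclusion.
  - by apply: sub1 (cross _ X a PRE rPR aPR avX); inclusion.
  - by apply: sub1 (cross _ R c YQE rYQ cYQ avR); inclusion.
have cW' : #|W'| <= 4.
  apply: card_majority => //; rewrite ?rYP ?rYS ?rPS //.
  - by apply: sub1 (cross _ Y a PRE rPR aPR avY); inclusion.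
  - by apply: sub1 (cross _ S c YQE rYQ cYQ avS); inclusion.
  - by apply: sub1 (cross _ P b XSE rXS bXS avP); inclusion.
have EU : E \subset T :|: (W :|: W') by rewrite defT /W /W'; inclusion.
have leU := subset_leq_card EU; have [le1 _] := leq_card_setU T (W :|: W').
by have [le2 _] := leq_card_setU W W'; rewrite cT in le1; arith.
Qed.

End NoSmallCocircuit.

Theorem theorem1p7 (U : finType) (M : matroid U) (T : {set U})
    (hM : minimally_vertically_connected M 4) (hT : triangle M T) :
  (exists C : {set U}, [/\ cocircuit M C, #|C| = 4 & #|C :&: T| = 2])
  \/ (exists C : {set U}, [/\ cocircuit M C, #|C| = 5,
        exists2 T' : {set U}, triangle M T' & T' \subset C
        & #|C :&: T| = 2])
  \/ #|ground M| <= 11.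
Proof.
have [[C /and3P[cocC /eqP cC /eqP CT]] | no4] :=
    altP (@existsP _ (fun C : {set U} =>
      [&& cocircuit M C, #|C| == 4 & #|C :&: T| == 2])).
  by left; exists C.
right.
have [[C /and4P[cocC /eqP cC /eqP CT /existsP[L /andP[tL LC]]]] | no5] :=
    altP (@existsP _ (fun C : {set U} =>
      [&& cocircuit M C, #|C| == 5, #|C :&: T| == 2
        & [exists L : {set U}, triangle M L && (L \subset C)]])).
  by left; exists C; split=> //; exists L.
right.
(* Removing one element from the triangle leaves an independent pair. *)
have rank_gt1 : 1 < rank M (ground M).
  case/andP: hT => /minsetP[/= /andP[TE niT] minT] /eqP cT.
  have [x xT] : exists x, x \in T by apply/card_gt0P; rewrite cT.
  have cTx : #|T :\ x| = 2 by have := cardsD1 x T; rewrite xT cT => -[->].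
  have TxE : T :\ x \subset ground M by apply: subset_trans TE; apply: subsetDl.
  suff iTx : indep M (T :\ x) by rewrite -cTx indep_leq_rank.
  apply: contraT => niTx; have /setP/(_ x) : T :\ x = T.
    by apply: minT; rewrite ?subsetDl //= TxE.
  by rewrite xT !inE eqxx.
have [le3 | gt3] := leqP (rank M (ground M)) 3.
  by apply: leq_trans (card_ground_rank3 hM rank_gt1 le3) _.
apply: (card_ground_rank_gt3 hM gt3 hT) => [C cocC CT cC | C L cocC CT tL LC cC].
  by move/existsPn/(_ C): no4; rewrite cocC cC CT.
move/existsPn/(_ C): no5; rewrite cocC cC CT /=; case/existsP.
by exists L; rewrite tL.
Qed.
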